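(* Let $r$ and $s$ be positive integers with $r \geq s \geq 2$. If $r > 2s - 2$, then $f(s,r,2) = f(s,r,\mathbb{Z}) = 2s + 2r - 2$.
   Context: For integers $a\le b$, $[a,b]=\{n\in\mathbb{N} : a\le n\le b\}$. For a finite set $X\subseteq\mathbb{N}$, $\mathrm{diam}(X)=\max(X)-\min(X)$. $f(s,r,2)$ is the smallest positive integer $n$ such that for every coloring $\Delta:[1,n]\to\{1,2\}$ there exist $S_1,S_2\subseteq[1,n]$ with: (a) $S_1$, $S_2$ each monochromatic (not necessarily the same color); (b) $|S_1|=s$, $|S_2|=r$; (c) $\max(S_1)<\min(S_2)$; (d) $\mathrm{diam}(S_1)\le\mathrm{diam}(S_2)$. Given $\Delta:[1,n]\to\mathbb{Z}$, a subset $Y$ is zero-sum mod $m$ if $\sum_{y\in Y}\Delta(y)\equiv 0\pmod m$. $f(s,r,\mathbb{Z})$ is the smallest positive integer $n$ such that for every coloring $\Delta:[1,n]\to\mathbb{Z}$ there exist $S_1,S_2\subseteq[1,n]$ satisfying (b), (c), (d) and (a') $S_1$ is zero-sum mod $s$ and $S_2$ is zero-sum mod $r$. *)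

(* Defs.v *)
From mathcomp Require Import all_boot all_order all_algebra finmap.

Set Implicit Arguments.
Unset Strict Implicit.
Unset Printing Implicit Defensive.

Local Open Scope nat_scope.

(* Both [maxS] and [minS] are 0 on the empty set; for nonempty X, seeding the
   iterated minimum with [maxS X] gives the true minimum. *)
Definition maxS (X : {fset nat}) : nat := \max_(x <- X) x.

Definition minS (X : {fset nat}) : nat := \big[minn/maxS X]_(x <- X) x.

Definition diam (X : {fset nat}) : nat := maxS X - minS X.

Definition within (n : nat) (X : {fset nat}) : Prop :=
  forall x, x \in X -> 1 <= x <= n.

(* A colouring of [1,n] is given by a function on all of nat; only its values
   on [1,n] matter, since it is only ever applied to elements of sets X with
   [within n X]. *)

Definition monochromatic (C : Type) (Delta : nat -> C) (X : {fset nat}) : Prop :=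
  forall x y, x \in X -> y \in X -> Delta x = Delta y.

Definition zero_sum_mod (m : nat) (Delta : nat -> int) (X : {fset nat}) : Prop :=
  ((\sum_(x <- X) Delta x)%R = 0 %[mod m])%Z.

Definition admissible_pair (s r n : nat) (S1 S2 : {fset nat}) : Prop :=
  [/\ within n S1 /\ within n S2,
      #|` S1| = s /\ #|` S2| = r,
      maxS S1 < minS S2
    & diam S1 <= diam S2].

Definition forces2 (s r n : nat) : Prop :=
  forall Delta : nat -> bool, exists S1 S2 : {fset nat},
    [/\ admissible_pair s r n S1 S2,
        monochromatic Delta S1 & monochromatic Delta S2].

Definition forcesZ (s r n : nat) : Prop :=
  forall Delta : nat -> int, exists S1 S2 : {fset nat},
    [/\ admissible_pair s r n S1 S2,
        zero_sum_mod s Delta S1 & zero_sum_mod r Delta S2].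

Definition is_smallest_positive (P : nat -> Prop) (n : nat) : Prop :=
  [/\ 0 < n, P n & forall m, 0 < m -> P m -> n <= m].

(* [is_f2 s r n] reads f(s,r,2) = n, and [is_fZ s r n] reads f(s,r,Z) = n;
   existence of the minimum is part of the assertion. *)
Definition is_f2 (s r n : nat) : Prop := is_smallest_positive (forces2 s r) n.

Definition is_fZ (s r n : nat) : Prop := is_smallest_positive (forcesZ s r) n.

(* Main.v *)
Require Import Defs.
From mathcomp Require Import all_boot all_order all_algebra all_field finmap.
From mathcomp Require Import zify.

Set Implicit Arguments.
Unset Strict Implicit.
Unset Printing Implicit Defensive.

Import GRing.Theory.

(** Upper bound: by the Erdős–Ginzburg–Ziv theorem, [1, 2s-1] contains a
    zero-sum [s]-set, of diameter at most [2s-2], and [2s, 2s+2r-2] contains a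
    zero-sum [r]-set, of diameter at least [r-1 >= 2s-2]. On 0/1-colourings
    zero-sum sets are monochromatic, so both upper bounds and both lower bounds
    follow at once from the integer upper bound and the 2-colour lower bound.

    Erdős–Ginzburg–Ziv is proved for a prime [p] by evaluating in [F_p] the sum,
    over all [p]-subsets [I] of the [2p-1] indices, of the [(p-1)]-st power of
    the sum over [I]. A monomial with [k] distinct variables, [0 < k < p], occurs
    in ['C(2p-1-k, p-k) = 0] of these powers, so the total is [0]; if no subset
    were zero-sum, Fermat would give ['C(2p-1, p) <> 0]. The general case is
    multiplicative in the modulus. *)

(** * Divisibility and counting with binomial coefficients *)

Lemma prime_ndvd_fact p k : prime p -> k < p -> ~~ (p %| k`!).
Proof.
move=> pp; elim: k => [|k IHk] lkp; first by rewrite fact0 Euclid_dvd1.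
by rewrite factS Euclid_dvdM // negb_or gtnNdvd //= IHk // ltnW.
Qed.

(** Since [p <= 2 * p - 1 - k], the prime divides the numerator factorial, but it divides neither
    [(p - k)!] nor [(p - 1)!]. *)
Lemma prime_dvd_bin_subset p k :
  prime p -> 0 < k < p -> p %| 'C(2 * p - 1 - k, p - k).
Proof.
move=> pp /andP[k0 kp].
have le : p - k <= 2 * p - 1 - k by lia.
have := dvdn_fact (m := p) (n := 2 * p - 1 - k).
rewrite -(bin_fact le) !Euclid_dvdM //.
rewrite (negPf (prime_ndvd_fact pp _)) ?orFb; last by lia.
rewrite (negPf (prime_ndvd_fact pp _)) ?orbF; last by lia.
by apply; lia.
Qed.

Lemma prime_ndvd_bin_central p : prime p -> ~~ (p %| 'C(2 * p - 1, p)).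
Proof.
move=> pp; have p1 := prime_gt1 pp.
rewrite -bin_sub; last by lia.
have -> : 2 * p - 1 - p = p.-1 by lia.
apply/negP => dvdC.
have : p %| (2 * p - 1) ^_ p.-1 by rewrite -bin_ffact dvdn_mulr.
rewrite ffact_prod Euclid_dvd_prod // big_has => /hasP[i _].
(* Every factor of this falling factorial lies strictly between [p] and [2 * p]. *)
by case/dvdnP => [[|[|q]]]; have := ltn_ord i; nia.
Qed.

(** Removing [K] is a bijection onto the subsets of [~: K] of size [m - #|K|]. *)
Lemma card_supersets (T : finType) (K : {set T}) m :
  #|K| <= m ->
  #|[set I : {set T} | K \subset I & #|I| == m]| = 'C(#|T| - #|K|, m - #|K|).
Proof.
move=> le_Km; rewrite -[in #|T| - _](setCK K) -cardsCs -(cards_draws (~: K)).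
rewrite -[RHS](@card_in_imset _ _ (setU K)); last first.
  move=> A B; rewrite !inE => /andP[sA _] /andP[sB _] eqAB.
  have disjE (C : {set T}) : C \subset ~: K -> (K :|: C) :\: K = C.
    move=> sC; rewrite setDUl setDv set0U; apply/setDidPl.
    by rewrite disjoints_subset.
  by rewrite -(disjE A sA) eqAB disjE.
apply: eq_card => I; rewrite inE; apply/andP/imsetP => [[sKI /eqP cI]|].
  exists (I :\: K); last first.
    by rewrite setDE setUIr setUCr setIT; apply/esym/setUidPr.
  by rewrite inE subsetDr cardsD (setIidPr sKI) cI eqxx.
move=> [A]; rewrite inE => /andP[sA /eqP cA] ->; split; first exact: subsetUl.
rewrite cardsU cA; have -> : K :&: A = set0.
  by apply/eqP; rewrite setI_eq0 disjoint_sym disjoints_subset.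
by rewrite cards0; lia.
Qed.

(** * The Erdős-Ginzburg-Ziv theorem *)

Lemma egz_prime_Fp p (T : finType) (a : T -> 'F_p) :
  prime p -> #|T| = 2 * p - 1 ->
  exists I : {set T}, #|I| = p /\ (\sum_(i in I) a i = 0)%R.
Proof.
move=> pp cT; have p1 := prime_gt1 pp.
case: (boolP [exists I : {set T}, (#|I| == p) && (\sum_(i in I) a i == 0)%R]).
  by case/existsP=> I /andP[/eqP cI /eqP sI]; exists I.
rewrite negb_exists => /forallP noI; exfalso.
have termE (I : {set T}) : #|I| == p -> ((\sum_(i in I) a i) ^+ p.-1 = 1)%R.
  move=> cI; have := noI I; rewrite cI /= => nz; apply: (mulfI nz).
  rewrite -exprS prednK ?prime_gt0 // mulr1.
  by have := expf_card (\sum_(i in I) a i)%R; rewrite card_Fp.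
have sum1 : (\sum_(I : {set T} | #|I| == p) (\sum_(i in I) a i) ^+ p.-1 =
             'C(2 * p - 1, p)%:R :> 'F_p)%R.
  rewrite (eq_bigr _ termE) sumr_const; congr (_%:R)%R.
  rewrite -cT -cardsT -cards_draws; apply: eq_card => I.
  by rewrite !inE subsetT.
have sum0 : (\sum_(I : {set T} | #|I| == p) (\sum_(i in I) a i) ^+ p.-1 =
             0 :> 'F_p)%R.
  (* The power expands into a sum over maps [f] from the [p.-1] factors to [T]; after exchanging
     sums, the product attached to [f] is counted once per [p]-set [I] containing the image of
     [f]. *)
  under eq_bigr => I _.
    rewrite -[X in (_ ^+ X)%R](card_ord p.-1) -prodr_const bigA_distr_big.
    over.
  rewrite (exchange_big_dep predT) //=; apply: big1 => f _.
  rewrite sumr_const -mulr_natr.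
  have cK1 : #|f @: [set: 'I_p.-1]| <= p.-1.
    by apply: leq_trans (leq_imset_card _ _) _; rewrite cardsT card_ord.
  (* An empty image would give the coefficient ['C(2 * p - 1, p)], which is nonzero mod [p]. *)
  have cK0 : 0 < #|f @: [set: 'I_p.-1]|.
    rewrite card_gt0; apply/set0Pn.
    have p0 : 0 < p.-1 by lia.
    by exists (f (Ordinal p0)); apply: imset_f.
  have -> : #|[pred I : {set T} | (#|I| == p) && (f \in ffun_on (mem I))]| =
            'C(2 * p - 1 - #|f @: [set: 'I_p.-1]|, p - #|f @: [set: 'I_p.-1]|).
    rewrite -cT -card_supersets; last by lia.
    apply: eq_card => I; rewrite !inE andbC; congr andb.
    apply/ffun_onP/subsetP => [fI x /imsetP[j _ ->]|sI j]; first exact: fI.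
    by apply: sI; apply: imset_f.
  have /eqP -> : ('C(2 * p - 1 - #|f @: [set: 'I_p.-1]|,
                   p - #|f @: [set: 'I_p.-1]|)%:R == 0 :> 'F_p)%R.
    by rewrite -(dvdn_pcharf (pchar_Fp pp)) prime_dvd_bin_subset //; lia.
  by rewrite mulr0.
move: (prime_ndvd_bin_central pp).
by rewrite (dvdn_pcharf (pchar_Fp pp)) -sum1 sum0 eqxx.
Qed.

(** Weighted sequences over any [eqType] allow repeated entries, and let the property be applied to
    sequences of blocks in the multiplicative step. *)
Definition egz_property (m : nat) : Prop :=
  forall (T : eqType) (a : T -> int) (s : seq T), 2 * m - 1 <= size s ->
  exists t u : seq T,
    [/\ perm_eq s (t ++ u), size t = m & (m %| \sum_(x <- t) a x)%Z%R].

Lemma egz_prime p : prime p -> egz_property p.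
Proof.
move=> pp T a s sz; have p1 := prime_gt1 pp.
case: s sz => [|x0 s'] /=; first by lia.
set s := x0 :: s' => sz.
pose n := 2 * p - 1.
have [I [cI sI]] :=
  @egz_prime_Fp p 'I_n (fun i => (a (nth x0 s i))%:~R)%R pp (card_ord _).
pose g (i : 'I_n) := nth x0 s i.
exists (map g (enum I)), (map g (enum (~: I)) ++ drop n s); split.
- rewrite catA -map_cat -{1}(cat_take_drop n s) perm_cat2r.
  have -> : take n s = map g (enum 'I_n).
    rewrite /g (map_comp (nth x0 s) val) val_enum_ord.
    rewrite -[LHS](mkseq_nth x0) /mkseq size_takel //; apply/eq_in_map => i.
    by rewrite mem_iota => /andP[_ lt]; rewrite nth_take.
  apply: perm_map; apply: uniq_perm; first exact: enum_uniq.
    rewrite cat_uniq !enum_uniq andbT /=; apply/hasPn => i.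
    by rewrite !mem_enum inE.
  by move=> i; rewrite mem_cat !mem_enum !inE orbN.
- by rewrite size_map -cardE.
rewrite (dvdz_pcharf (pchar_Fp pp)) big_map big_enum /= rmorph_sum /=.
by rewrite sI.
Qed.

(* As long as fewer than [k] blocks of size [p] have been removed, at least
   [2 * p - 1] elements are left, so one more block can be extracted. *)
Lemma egz_blocks p k (T : eqType) (a : T -> int) (s : seq T) :
  egz_property p -> 0 < p -> k.+1 * p - 1 <= size s ->
  exists (L : seq (seq T)) (u : seq T),
    [/\ perm_eq s (flatten L ++ u), size L = k &
        forall t, t \in L -> size t = p /\ (p %| \sum_(x <- t) a x)%Z%R].
Proof.
move=> egzp p0; elim: k s => [|k IHk] s sz; first by exists [::], s; split.
have [|t [v [perm_s szt dvdt]]] := egzp T a s; first by nia.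
have [|L [u [perm_v szL dvdL]]] := IHk v.
  by move: (perm_size perm_s) sz; rewrite size_cat szt; nia.
exists (t :: L), u; split=> /=; last 1 first.
- by move=> t'; rewrite inE => /predU1P[->|/dvdL].
- by rewrite -catA (perm_trans perm_s) // perm_cat2l.
- by rewrite szL.
Qed.

(** From [2 * p * q - 1] terms one extracts [2 * q - 1] blocks of size [p] with sum divisible by
    [p]. Among their sums divided by [p], some [q] add up to a multiple of [q]; these blocks are
    concatenated. *)
Lemma egz_mul p q :
  0 < p -> 0 < q -> egz_property p -> egz_property q -> egz_property (p * q).
Proof.
move=> p0 q0 egzp egzq T a s sz.
have [|L [u [perm_s szL dvdL]]] := @egz_blocks p (2 * q - 1) T a s egzp p0.
  by nia.
have [|L1 [L2 [perm_L szL1 dvdL1]]] :=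
  egzq _ (fun t : seq T => (\sum_(x <- t) a x)%R %/ p)%Z L; first by rewrite szL.
have inL t : t \in L1 -> size t = p /\ (p %| \sum_(x <- t) a x)%Z%R.
  by move=> tL1; apply: dvdL; rewrite (perm_mem perm_L) mem_cat tL1.
exists (flatten L1), (flatten L2 ++ u); split.
- rewrite catA -flatten_cat (perm_trans perm_s) // perm_cat2r.
  exact: perm_flatten.
- rewrite size_flatten /shape -szL1 mulnC.
  elim: L1 {szL1 dvdL1 perm_L} inL => [|t L1 IH] inL //=.
  rewrite IH => [|t' tL]; last by apply: inL; rewrite inE tL orbT.
  by case: (inL t (mem_head _ _)) => -> _.
rewrite big_flatten /=.
under eq_big_seq => t /inL[_ dvdt] do rewrite -(divzK dvdt).
by rewrite -mulr_suml PoszM mulrC dvdz_mul.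
Qed.

Theorem erdos_ginzburg_ziv m : 0 < m -> egz_property m.
Proof.
elim/ltn_ind: m => m IHm m0.
case: (ltngtP m 1) => [|m1|->]; first by lia.
  rewrite -(divnK (pdiv_dvd m)); have pp := pdiv_prime m1.
  have p1 := prime_gt1 pp; have q0 : 0 < m %/ pdiv m.
    by rewrite divn_gt0 ?pdiv_gt0 // pdiv_leq.
  apply: egz_mul => //; first by apply: IHm => //; rewrite ltn_Pdiv.
  exact: egz_prime.
move=> T a [|x s] // _; exists [:: x], s; split=> //; exact: dvd1z.
Qed.

Lemma egz_fset m (X : {fset nat}) (Delta : nat -> int) :
  0 < m -> 2 * m - 1 <= #|` X| ->
  exists Y : {fset nat}, [/\ {subset Y <= X}, #|` Y| = m &
    zero_sum_mod m Delta Y].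
Proof.
move=> m0 cX.
have [t [u [perm_X szt dvdt]]] := erdos_ginzburg_ziv m0 Delta cX.
have uniq_t : uniq t.
  by have := fset_uniq X; rewrite (perm_uniq perm_X) cat_uniq => /and3P[].
have perm_t : perm_eq (seq_fset tt t) t.
  by rewrite -{2}(undup_id uniq_t) seq_fset_perm.
exists (seq_fset tt t); split.
- by move=> x; rewrite seq_fsetE (perm_mem perm_X) mem_cat => ->.
- by rewrite size_seq_fset undup_id.
by rewrite /zero_sum_mod (perm_big _ perm_t) /= mod0z; apply/dvdz_mod0P.
Qed.

(** * Extrema, diameter and cardinality of finite sets *)

Lemma leq_maxS (X : {fset nat}) x : x \in X -> x <= maxS X.
Proof. by move=> xX; apply: leq_bigmax_seq. Qed.

Lemma maxS_leq (X : {fset nat}) b : (forall x, x \in X -> x <= b) -> maxS X <= b.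
Proof. by move=> h; apply/bigmax_leqP_seq => x xX _; apply: h. Qed.

Lemma minS_leq (X : {fset nat}) x : x \in X -> minS X <= x.
Proof.
rewrite /minS; move: (maxS X) => d; rewrite -[x \in X]/(x \in (X : seq nat)).
elim: (X : seq nat) => // y l IH; rewrite inE big_cons => /predU1P[->|/IH h].
  exact: geq_minl.
exact: leq_trans (geq_minr _ _) h.
Qed.

Lemma leq_minS (X : {fset nat}) b :
  0 < #|` X| -> (forall x, x \in X -> b <= x) -> b <= minS X.
Proof.
rewrite cardfs_gt0 => /fset0Pn[x0 x0X] h.
rewrite /minS big_seq; apply: (big_ind (fun y => b <= y)) => //.
(* The seed [maxS X] of the iterated minimum must be bounded below too. *)
- exact: leq_trans (h _ x0X) (leq_maxS x0X).
- by move=> y z hy hz; rewrite leq_min hy.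
Qed.

Lemma card_fset_leq_interval (X : {fset nat}) a k :
  (forall x, x \in X -> a <= x < a + k) -> #|` X| <= k.
Proof.
move=> h; rewrite -(size_iota a k); apply: uniq_leq_size; first exact: fset_uniq.
by move=> x xX; rewrite mem_iota h.
Qed.

Lemma card_leq_diam (X : {fset nat}) : #|` X| <= (diam X).+1.
Proof.
apply: (@card_fset_leq_interval _ (minS X)) => x xX.
have := leq_maxS xX; have := minS_leq xX; rewrite /diam; lia.
Qed.

(** * Upper bound for integer colourings and its transfer to two colours *)

Lemma egz_interval m a (Delta : nat -> int) : 0 < m ->
  exists Y : {fset nat}, [/\ forall x, x \in Y -> a <= x < a + (2 * m - 1),
    #|` Y| = m & zero_sum_mod m Delta Y].
Proof.
move=> m0.
have [|Y [sY cY zY]] := @egz_fset m (seq_fset tt (iota a (2 * m - 1))) Delta m0.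
  by rewrite size_seq_fset undup_id ?iota_uniq // size_iota.
by exists Y; split=> // x /sY; rewrite seq_fsetE mem_iota.
Qed.

Lemma forcesZ_upper s r : 0 < s -> 2 * s - 2 < r ->
  forcesZ s r (2 * s + 2 * r - 2).
Proof.
move=> s0 hr Delta; have r0 : 0 < r by lia.
have [S1 [in1 c1 z1]] := egz_interval 1 Delta s0.
have [S2 [in2 c2 z2]] := egz_interval (2 * s) Delta r0.
have max1 : maxS S1 <= 2 * s - 1 by apply: maxS_leq => x /in1; lia.
have min1 : 1 <= minS S1 by apply: leq_minS => [|x /in1]; lia.
have min2 : 2 * s <= minS S2 by apply: leq_minS => [|x /in2]; lia.
exists S1, S2; split=> //; split=> //.
- by split=> x => [/in1|/in2]; lia.
- by lia.
by have := card_leq_diam S2; rewrite c2 [diam S1]/diam; lia.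
Qed.

(* A zero-sum set of size [m] in a 0/1-colouring has sum 0 or [m]. *)
Lemma zero_sum_monochromatic m (Delta : nat -> bool) (X : {fset nat}) :
  #|` X| = m -> zero_sum_mod m (fun x => Posz (Delta x)) X ->
  monochromatic Delta X.
Proof.
move=> cX; rewrite /zero_sum_mod mod0z.
have -> : (\sum_(x <- X) Posz (Delta x))%R = Posz (count Delta X).
  elim: (X : seq nat) => [|x l IH]; first by rewrite big_nil.
  by rewrite big_cons IH /= PoszD.
move/dvdz_mod0P; rewrite dvdzE /= => dvdm x y xX yX.
have : (count Delta X == 0) || (count Delta X == size X).
  have := count_size Delta X; rewrite -[size X]/(#|` X|) cX => cle.
  by case: (posnP (count Delta X)) => //= c0; have := dvdn_leq c0 dvdm; lia.
case/orP; last by rewrite -all_count => /allP h; rewrite !h.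
by rewrite -leqn0 leqNgt -has_count => /hasPn h; rewrite !(negPf (h _ _)).
Qed.

Lemma forcesZ_forces2 s r n : forcesZ s r n -> forces2 s r n.
Proof.
move=> fZ Delta; have [S1 [S2 [adm z1 z2]]] := fZ (fun x => Posz (Delta x)).
have [_ [c1 c2] _ _] := adm.
by exists S1, S2; split=> //; apply: zero_sum_monochromatic; eassumption.
Qed.

(** * Lower bound from an extremal two-colouring *)

(** The two colour classes are consecutive blocks of length [k], and a monochromatic set stays in
    one of them. *)
Lemma card_two_blocks (Delta : nat -> bool) (X : {fset nat}) a k :
  (forall x, x \in X -> a <= x < a + 2 * k /\ Delta x = (x < a + k)) ->
  monochromatic Delta X -> #|` X| <= k.
Proof.
move=> h mono; have [->|/fset0Pn[x0 x0X]] := eqVneq X fset0.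
  by rewrite cardfs0.
have sameX x : x \in X -> (x < a + k) = (x0 < a + k).
  move=> xX; have := mono _ _ xX x0X.
  by case: (h _ xX) => _ ->; case: (h _ x0X) => _ ->.
case: (ltnP x0 (a + k)) => lt0.
  apply: (@card_fset_leq_interval _ a) => x xX.
  by have := sameX _ xX; have [] := h _ xX; lia.
apply: (@card_fset_leq_interval _ (a + k)) => x xX.
by have := sameX _ xX; have [] := h _ xX; lia.
Qed.

(* The colouring 1^(s-1) 2^s 1^(r-1) 2^(r-1) of [1, 2s+2r-3]: a
   monochromatic [s]-set must reach position [2s-1], after which only [r-1]
   positions of each colour remain. *)
Lemma forces2_lower s r n : 0 < s -> 0 < r ->
  forces2 s r n -> 2 * s + 2 * r - 2 <= n.
Proof.
move=> s0 r0 f2; rewrite leqNgt; apply/negP => ltn.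
pose Delta x := (x < s) || (2 * s <= x < 2 * s + (r - 1)).
have [S1 [S2 [[[in1 in2] [c1 c2] lt12 _] m1 m2]]] := f2 Delta.
have [x xS1 xge] : exists2 x, x \in S1 & 2 * s - 1 <= x.
  case: (boolP (has (leq (2 * s - 1)) S1)) => [/hasP[x xS1 le]|/hasPn h].
    by exists x.
  (* Otherwise [S1] lies in [[1, 2s-2]], two blocks of length [s - 1]. *)
  suff : #|` S1| <= s - 1 by lia.
  apply: (card_two_blocks (Delta := Delta) (a := 1)) => // x xS1.
  by have := in1 _ xS1; have := h _ xS1; rewrite /Delta; lia.
(* Beyond [x], [S2] is confined to [[2s, 2s+2r-3]], two blocks of length [r - 1]. *)
suff : #|` S2| <= r - 1 by lia.
apply: (card_two_blocks (Delta := Delta) (a := 2 * s)) => // y yS2.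
have := leq_maxS xS1; have := minS_leq yS2; have := in2 _ yS2.
by rewrite /Delta; lia.
Qed.

Theorem theorem3p4 (r s : nat) (hs : 2 <= s) (hsr : s <= r)
    (hr : 2 * s - 2 < r) :
  is_f2 s r (2 * s + 2 * r - 2) /\ is_fZ s r (2 * s + 2 * r - 2).
Proof.
have s0 : 0 < s by lia.
have r0 : 0 < r by lia.
have fZ := forcesZ_upper s0 hr.
split; (split; first by lia).
- exact: forcesZ_forces2.
- by move=> m _; apply: forces2_lower.
- exact: fZ.
- by move=> m _ /forcesZ_forces2; apply: forces2_lower.
Qed.
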